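(* Let $\ell>2$ be a natural number. Then Henson's universal $K_\ell$-free graph $\mathbf H_\ell$ is not finitely retractable.
   Context: A graph is a pair $G=(V,E)$ where $E$ is a symmetric and reflexive binary relation on $V$ (every vertex has a loop). A graph homomorphism is an edge-preserving map (so distinct adjacent vertices may be mapped to the same vertex). $K_n$ is the complete graph with $n$ vertices; a graph is $K_n$-free if it does not contain $n$ distinct pairwise adjacent vertices. $\mathbf H_n$ (Henson's universal $K_n$-free graph) is the Fraïssé limit of the class of finite $K_n$-free graphs: the unique (up to isomorphism) countable $K_n$-free graph which contains an isomorphic copy (as induced subgraph) of every countable $K_n$-free graph and is homogeneous, i.e. every isomorphism between finite induced subgraphs extends to an automorphism. A retraction of a graph $X$ is a homomorphism $r\colon X\to X$ that is the identity on its range. A graph $X$ is finitely retractable if for every finite $F\subseteq X$ there is a retraction $r\colon X\to X$ with $F\subseteq r[X]$ and $r[X]$ finite. *)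

(* Defs.v *)
From mathcomp Require Import all_boot.
From mathcomp Require Import boolp classical_sets functions cardinality.

Set Implicit Arguments.
Unset Strict Implicit.
Unset Printing Implicit Defensive.

Local Open Scope classical_set_scope.

Record graph := Graph {
  vertex :> Type;
  adj : vertex -> vertex -> Prop;
  adj_refl : forall x, adj x x;
  adj_sym : forall x y, adj x y -> adj y x }.

(* Every vertex has a loop, so distinct adjacent vertices may be identified. *)
Definition graph_hom (X Y : graph) (f : X -> Y) : Prop :=
  forall x y : X, adj x y -> adj (f x) (f y).

(* An isomorphism onto an induced subgraph of [Y]. *)
Definition graph_embedding (X Y : graph) (f : X -> Y) : Prop :=
  injective f /\ forall x y : X, adj (f x) (f y) <-> adj x y.

Definition graph_automorphism (X : graph) (g : X -> X) : Prop :=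
  bijective g /\ forall x y : X, adj (g x) (g y) <-> adj x y.

(* [f] is an isomorphism between the subgraphs of [X] induced on [A] and [B];
   its values outside [A] are irrelevant. *)
Definition induced_iso (X : graph) (A B : set X) (f : X -> X) : Prop :=
  set_bij A B f /\ forall x y : X, A x -> A y -> (adj (f x) (f y) <-> adj x y).

Definition homogeneous_graph (X : graph) : Prop :=
  forall (A B : set X) (f : X -> X),
    finite_set A -> finite_set B -> induced_iso A B f ->
    exists g : X -> X, graph_automorphism g /\ forall x, A x -> g x = f x.

Definition K_free (n : nat) (X : graph) : Prop :=
  ~ exists v : 'I_n -> X, injective v /\ forall i j : 'I_n, adj (v i) (v j).

Definition countable_graph (X : graph) : Prop := countable [set: X].

(* These properties determine a graph up to isomorphism, so a statement about
   Henson's graph is a statement about every graph satisfying them. *)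
Definition is_Henson_graph (n : nat) (H : graph) : Prop :=
  [/\ countable_graph H,
      K_free n H,
      (forall X : graph, countable_graph X -> K_free n X ->
         exists f : X -> H, graph_embedding f)
    & homogeneous_graph H].

Definition retraction (X : graph) (r : X -> X) : Prop :=
  graph_hom r /\ forall y, range r y -> r y = y.

Definition finitely_retractable (X : graph) : Prop :=
  forall F : set X, finite_set F ->
    exists r : X -> X,
      [/\ retraction r, F `<=` range r & finite_set (range r)].

(* Main.v *)
Require Import Defs.
From mathcomp Require Import all_boot.
From mathcomp Require Import boolp classical_sets functions cardinality.
From mathcomp Require Import zify.

Set Implicit Arguments.
Unset Strict Implicit.
Unset Printing Implicit Defensive.

(** The idea is a countable [K_l]-free graph [X] with a finite core such that
    every homomorphism from [X] to a [K_l]-free graph that embeds the core takes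
    infinitely many values. Only universality of Henson's graph is then needed:
    embed [X] and let [F] be the image of the core; a retraction fixing [F]
    cannot have finite range.

    For [l = 3] the core has three nonadjacent pairs with an edge between any two
    of them. Every other vertex is coloured by one of the pairs and joined to
    both its members; nonadjacency within a pair keeps its image off the pair,
    and the edges between pairs prevent vertices of different colours from being
    identified. The coloured vertices are [g_i, h_i, k_i] with edges [g_i h_i],
    [g_i k_i], and [h_i k_j] for [i < j], so that identifying [g_i] with [g_j]
    creates the triangle [g_i h_i k_j]. Passing from [l] to [l + 1] amounts to
    joining two nonadjacent vertices to everything. *)

(** The target [Y] is arbitrary so that the induction on [n] can replace it by a common
    neighbourhood inside it. *)
Definition rigid_along (n : nat) (X : graph) (C : set X) (g : nat -> X) : Prop :=
  forall (Y : graph) (phi : X -> Y), K_free n Y -> graph_hom phi ->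
    (forall x y, C x -> C y -> phi x = phi y -> x = y) ->
    (forall x y, C x -> C y -> adj (phi x) (phi y) -> adj x y) ->
    injective (phi \o g).

Definition has_rigid_core (n : nat) (X : graph) : Prop :=
  exists (C : set X) (g : nat -> X), finite_set C /\ rigid_along n C g.

Lemma K3_free_triangle (Y : graph) (a b c : Y) : K_free 3 Y ->
  adj a b -> adj b c -> adj a c -> a <> b -> b <> c -> a <> c -> False.
Proof.
move=> Y3 ab bc ac nab nbc nac; apply: Y3.
exists (fun i : 'I_3 => nth a [:: a; b; c] i); split.
  case=> [[|[|[|//]]] ?]; case=> [[|[|[|//]]] ?] //= e; first
    [exact: val_inj | by case: nab | by case: nbc | by case: nac].
by case=> [[|[|[|//]]] ?]; case=> [[|[|[|//]]] ?] //=;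
  first [exact: adj_refl | exact: adj_sym].
Qed.

Section TriangleFree.

(* [(c, inl b)] is a member of the core pair of colour [c]; [(0, inr i)],
   [(1, inr i)], [(2, inr i)] are [g_i], [h_i], [k_i]. *)
Definition tf_vertex : Type := ('I_3 * (bool + nat))%type.

Definition tf_arc (x y : tf_vertex) : bool :=
  match x, y with
  | (c, inl b), (d, inl b') => [&& b, ~~ b' & d == c.+1 %% 3 :> nat]
  | (c, inl _), (d, inr _) => c == d :> nat
  | (c, inr i), (d, inr j) =>
      [&& c == 0 :> nat, 0 < d & i == j]
      || [&& c == 1 :> nat, d == 2 :> nat & i < j]
  | _, _ => false
  end.

Definition tf_edge (x y : tf_vertex) : bool := tf_arc x y || tf_arc y x.

(** Edges inside the core form a perfect matching. Adjacent core vertices differ in colour, and so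
    do adjacent vertices outside the core, so no triangle mixes the two kinds. A triangle outside
    the core would be [g_i], [h_i], [k_i], but [h_i k_i] is not an edge. *)
Lemma tf_edge_triangle (x y z : tf_vertex) :
  tf_edge x y -> tf_edge y z -> tf_edge x z -> False.
Proof.
rewrite /tf_edge; case: x => [[[|[|[|//]]] ?] [a|i]];
  case: y => [[[|[|[|//]]] ?] [b|j]]; rewrite ?orbF ?andbF //=;
  case: z => [[[|[|[|//]]] ?] [c|k]]; rewrite ?orbF ?andbF //=.
all: lia.
Qed.

Lemma tf_edge_sym (x y : tf_vertex) : tf_edge x y -> tf_edge y x.
Proof. by rewrite /tf_edge orbC. Qed.

Definition tf_graph : graph.
Proof.
refine (@Graph tf_vertex (fun x y => x = y \/ tf_edge x y) _ _).
  by left.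
by move=> x y [->|/tf_edge_sym]; [left | right].
Defined.

Lemma tf_graph_countable : countable_graph tf_graph.
Proof. exact: (@countableP tf_vertex). Qed.

Lemma tf_graph_K3_free : K_free 3 tf_graph.
Proof.
case=> v [v_inj v_adj].
have edge i j : i != j -> tf_edge (v i) (v j).
  by case: (v_adj i j) => // /v_inj ->; rewrite eqxx.
by apply: (@tf_edge_triangle (v ord0) (v (inord 1)) (v (inord 2)));
  apply: edge; rewrite -val_eqE /= !inordK.
Qed.

Definition tf_core : set tf_graph := [set x | if x.2 is inl _ then True else False].

Lemma tf_core_finite : finite_set tf_core.
Proof.
apply: (@sub_finite_set _ _
  ((fun cb : 'I_3 * bool => (cb.1, inl cb.2) : tf_graph) @` [set: 'I_3 * bool]%classic)).
  by move=> [c [b|//]] _; exists (c, b).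
by apply: finite_image; exact: finite_finset.
Qed.

Definition tf_ray (i : nat) : tf_graph := (ord0, inr i).

Lemma tf_rigid : rigid_along 3 tf_core tf_ray.
Proof.
move=> Y phi Y3 hom inj emb.
have core_neq x y : tf_core x -> tf_core y -> x != y -> phi x <> phi y.
  by move=> Cx Cy /eqP + /(inj _ _ Cx Cy).
have off_pair (c : 'I_3) b i : phi (c, inr i) <> phi (c, inl b).
  move=> e; have /(emb (c, inl (~~ b)) (c, inl b) I I) :
      adj (phi (c, inl (~~ b))) (phi (c, inl b)).
    by rewrite -e; apply: hom; right; rewrite /tf_edge /= eqxx.
  case=> [[]|]; first by case: (b).
  by rewrite /tf_edge /=; case: (c) => [[|[|[|//]]] ?]; lia.
(* Cyclically consecutive colours suffice: any two distinct colours are consecutive in one of the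
   two orders. *)
have next_neq (c d : 'I_3) i j : d = c.+1 %% 3 :> nat ->
    phi (c, inr i) <> phi (d, inr j).
  move=> dc e; apply: (@K3_free_triangle Y (phi (c, inr i))
    (phi (c, inl true)) (phi (d, inl false)) Y3).
  - by apply: hom; right; rewrite /tf_edge /= eqxx.
  - by apply: hom; right; rewrite /tf_edge /= dc eqxx.
  - by rewrite e; apply: hom; right; rewrite /tf_edge /= eqxx.
  - exact: off_pair.
  - by apply: core_neq => //; apply/eqP; case.
  - by rewrite e; exact: off_pair.
have ray_neq i j : i < j -> phi (tf_ray i) <> phi (tf_ray j).
  move=> ij e.
  have o1 : 1 < 3 by []. have o2 : 2 < 3 by [].
  apply: (@K3_free_triangle Y (phi (tf_ray i))
    (phi (Ordinal o1, inr i)) (phi (Ordinal o2, inr j)) Y3).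
  - by apply: hom; right; rewrite /tf_edge /= eqxx.
  - by apply: hom; right; rewrite /tf_edge /= ij.
  - by rewrite e; apply: hom; right; rewrite /tf_edge /= eqxx.
  - exact: next_neq.
  - exact: next_neq.
  - by rewrite e => /esym; exact: next_neq.
move=> i j /= e; case: (ltngtP i j) => // [/ray_neq|/ray_neq/nesym] //.
Qed.

End TriangleFree.

Section Suspension.

Definition susp_adj (X : graph) (x y : X + bool) : Prop :=
  match x, y with
  | inl a, inl b => adj a b
  | inr a, inr b => a = b
  | _, _ => True
  end.

Definition susp (X : graph) : graph.
Proof.
refine (@Graph (X + bool)%type (@susp_adj X) _ _).
  by case=> [x|b] //=; exact: adj_refl.
by case=> [x|b] [y|c] //=; exact: adj_sym.
Defined.

Lemma susp_countable (X : graph) : countable_graph X -> countable_graph (susp X).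
Proof.
move=> /countable_injP [f f_inj]; apply/countable_injP.
exists (fun x : susp X => match x with inl a => (f a).+2 | inr b => b : nat end).
move=> [a|b] [a'|b'] _ _ //=.
- by move=> [] /f_inj ->; rewrite ?inE.
- by case: b'.
- by case: b.
- by case: b; case: b'.
Qed.

Lemma susp_K_free (n : nat) (X : graph) : K_free n X -> K_free n.+1 (susp X).
Proof.
move=> Xn [v [v_inj v_adj]].
(* The poles are nonadjacent, so a clique contains at most one; [i] is its index, or arbitrary if
   there is none. *)
have [i vi] : exists i, forall j, j != i -> exists x, v j = inl x.
  have [[i [b vi]]|no] := pselect (exists i b, v i = inr b).
    exists i => j ji; case vj: (v j) => [x|c]; first by exists x.
    have := v_adj i j; rewrite vi vj /= => bc.
    by have /v_inj ij : v i = v j; [rewrite vi vj bc | rewrite ij eqxx in ji].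
  exists ord0 => j _; case vj: (v j) => [x|c]; first by exists x.
  by case: no; exists j, c.
have /choice [w vw] : forall j : 'I_n, exists x, v (lift i j) = inl x.
  by move=> j; apply: vi; rewrite eq_sym neq_lift.
apply: Xn; exists w; split=> [j k e|j k].
  by apply: (@lift_inj _ i); apply: v_inj; rewrite !vw e.
by have := v_adj (lift i j) (lift i k); rewrite !vw.
Qed.

Definition common_nbhd (Y : graph) (u w : Y) : graph.
Proof.
refine (@Graph {y : Y | adj u y /\ adj w y} (fun y z => adj (sval y) (sval z)) _ _).
  by move=> y; exact: adj_refl.
by move=> y z; exact: adj_sym.
Defined.

(** Adding [u] to a clique of common neighbours gives a larger clique. Because of loops [u] could
    already belong to it, but then [u] would be adjacent to [w]. *)
Lemma common_nbhd_K_free (n : nat) (Y : graph) (u w : Y) :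
  ~ adj u w -> K_free n.+1 Y -> K_free n (common_nbhd u w).
Proof.
move=> uw Yn [v [v_inj v_adj]]; apply: Yn.
have vu j : sval (v j) <> u.
  by move=> e; apply: uw; apply: adj_sym; rewrite -e; case: (v j) => ? [].
exists (fun i => oapp (fun j => sval (v j)) u (unlift ord0 i)); split.
  move=> i j; case: (unliftP ord0 i) => [k ->|->];
    case: (unliftP ord0 j) => [k' ->|->] //=.
  - move=> e; congr (lift _ _); apply: v_inj.
    by case: (v k) (v k') e => [? ?] [? ?] /= e; exact: eq_exist.
  - by move/vu.
  - by move/esym/vu.
move=> i j; case: (unliftP ord0 i) => [k _|_];
  case: (unliftP ord0 j) => [k' _|_] /=.
- exact: v_adj.
- by apply: adj_sym; case: (v k) => ? [].
- by case: (v k') => ? [].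
- exact: adj_refl.
Qed.

Definition susp_core (X : graph) (C : set X) : set (susp X) :=
  [set x | if x is inl a then C a else True].

Lemma susp_core_finite (X : graph) (C : set X) :
  finite_set C -> finite_set (susp_core C).
Proof.
move=> Cfin; apply: (@sub_finite_set _ _
  ((fun a => inl a : susp X) @` C `|` (fun b => inr b : susp X) @` [set: bool])%classic).
  by move=> [a|b] /= Cx; [left; exists a | right; exists b].
by rewrite finite_setU; split; apply: finite_image.
Qed.

(* The images of the two poles are nonadjacent, so a homomorphism maps [X] into
   their common neighbourhood, which has smaller clique number. *)
Lemma susp_rigid (n : nat) (X : graph) (C : set X) (g : nat -> X) :
  rigid_along n C g -> rigid_along n.+1 (susp_core C) (fun i => inl (g i) : susp X).
Proof.
move=> Xrigid Y phi Yn hom inj emb.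
pose u := phi (inr true); pose w := phi (inr false).
have uw : ~ adj u w by move=> /(emb (inr true) (inr false) I I).
have nbhd x : adj u (phi (inl x)) /\ adj w (phi (inl x)) by split; apply: hom.
pose psi x : common_nbhd u w := exist _ (phi (inl x)) (nbhd x).
have psi_inj : injective (psi \o g).
  apply: Xrigid; first exact: common_nbhd_K_free uw Yn.
  - by move=> x y xy; exact: (hom (inl x) (inl y)).
  - by move=> x y Cx Cy [] /(inj (inl x) (inl y) Cx Cy) [].
  - by move=> x y Cx Cy; exact: (emb (inl x) (inl y) Cx Cy).
by move=> i j /= e; apply: psi_inj; exact: eq_exist.
Qed.

End Suspension.

Lemma rigid_graph_exists (n : nat) : 2 < n -> exists X : graph,
  [/\ countable_graph X, K_free n X & has_rigid_core n X].
Proof.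
elim: n => // n IH; rewrite ltnS leq_eqVlt => /predU1P [<-|/IH].
  exists tf_graph; split; [exact: tf_graph_countable | exact: tf_graph_K3_free |].
  by exists tf_core, tf_ray; split; [exact: tf_core_finite | exact: tf_rigid].
move=> [X [Xc Xn [C [g [Cfin Xrigid]]]]].
exists (susp X); split; [exact: susp_countable | exact: susp_K_free |].
exists (susp_core C), (fun i => inl (g i)).
by split; [exact: susp_core_finite | exact: susp_rigid].
Qed.

Theorem theorem8p1 (l : nat) (hl : 2 < l) (H : graph)
    (hH : is_Henson_graph l H) : ~ finitely_retractable H.
Proof.
case: hH => _ Hl univ _ retr.
have [X [Xc Xl [C [g [Cfin Xrigid]]]]] := rigid_graph_exists hl.
have [f [f_inj f_adj]] := univ X Xc Xl.
have [r [[r_hom r_id] Fr rfin]] := retr (f @` C)%classic (finite_image _ Cfin).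
have rf x : C x -> r (f x) = f x by move=> Cx; apply/r_id/Fr; exists x.
have rfg_inj : injective ((r \o f) \o g).
  apply: Xrigid => //.
  - by move=> x y xy; apply: r_hom; apply/f_adj.
  - by move=> x y Cx Cy /=; rewrite !rf // => /f_inj.
  - by move=> x y Cx Cy /=; rewrite !rf // => /f_adj.
(* An injection of the naturals into the finite range of [r] would make them finite. *)
apply: infinite_nat.
have <- : ((r \o f \o g) @^-1` range r)%classic = setT.
  by apply/seteqP; split=> // i _; exists (f (g i)).
by apply: finite_preimage rfin => i j _ _ /rfg_inj.
Qed.
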